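(* Let $q$ be a real number with $q\neq 0,\pm1$, let $m$ be a positive integer and let $n=2m$. The $n$-th symmetric Gaussian Riemann difference ${_q}\Delta_n^s(x,h;f)$ is the $n$-th generalized Riemann difference based at $x,x\pm h,x\pm qh,x\pm q^2h,\ldots ,x\pm q^{m-1}h$, and it has the expression ${_q}\Delta_n^s(x,h;f)=\lambda_n^s\cdot {_q}\widetilde{\Delta}_n^s(x,h;f)$, where $${_q}\widetilde{\Delta}_n^s(x,h;f)=\sum_{k=0}^{m-1}(-1)^kq^{k(k+1)}\left[\begin{array}{c}m-1\\k\end{array}\right]_{q^2}\left\{f(x+q^{m-1-k}h)+f(x-q^{m-1-k}h)\right\}-2(1-q^2)(1-q^4)\cdots (1-q^{2(m-1)})f(x)$$ and $\lambda_n^s=n!/\left(2(q^n-q^2)(q^n-q^4)\cdots (q^n-q^{n-2})\right)$.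
   Context: An $n$-th generalized Riemann difference is $\Delta_{\mathcal{A}}(x,h;f)=\sum_{k=0}^{\ell}A_kf(x+a_kh)$, where the real numbers $A_k$ are non-zero, the real numbers $a_k$ are distinct, and $\sum_{k=0}^{\ell}A_ka_k^j=\delta_{j,n}\cdot n!$ for $j=0,1,\ldots ,n$ (with $0^0=1$). The points $x+a_kh$ are its base points. When there are exactly $n+1$ base points, the $A_k$ are uniquely determined by the $a_k$. For even $n$ with $m=\lfloor (n+1)/2\rfloor=n/2$, the $n$-th symmetric Gaussian Riemann difference is by definition the $n$-th generalized Riemann difference based at $x,x\pm h,x\pm qh,\ldots ,x\pm q^{m-1}h$. For real $p$: $[k]_p=1+p+\cdots +p^{k-1}$, $[k]_p!=[1]_p[2]_p\cdots [k]_p$ with $[0]_p!=1$, and $\left[\begin{array}{c}n\\k\end{array}\right]_p=\frac{[n]_p!}{[n-k]_p!\,[k]_p!}$ for $0\le k\le n$; here it is used with $p=q^2$. Empty products equal $1$. *)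

(* Defs.v *)
From HB Require Import structures.
From mathcomp Require Import all_boot all_order all_algebra.
From mathcomp Require Import reals.

Set Implicit Arguments.
Unset Strict Implicit.
Unset Printing Implicit Defensive.

Import Order.TTheory GRing.Theory Num.Theory.
Local Open Scope ring_scope.

Section GeneralizedRiemannDifferences.
Variable R : realType.

(* A difference acts on a point x, a step h and a function f. *)
Definition difference := R -> R -> (R -> R) -> R.

Definition riemann_difference (l : nat) (A a : 'I_l.+1 -> R) : difference :=
  fun x h f => \sum_(k < l.+1) A k * f (x + a k * h).

(* The convention 0 ^ 0 = 1 holds for ^+ by definition. *)
Definition gen_riemann_conditions (n l : nat) (A a : 'I_l.+1 -> R) : Prop :=
  [/\ forall k, A k != 0,
      injective a
    & forall j, (j <= n)%N ->
        \sum_(k < l.+1) A k * a k ^+ j = if j == n then n`!%:R else 0].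

(* D is an n-th generalized Riemann difference whose base points are exactly
   the x + b h with b in the list [nodes]; order and repetitions in [nodes] are
   irrelevant. *)
Definition gen_riemann_difference_based_at
    (n : nat) (nodes : seq R) (D : difference) : Prop :=
  exists (l : nat) (A a : 'I_l.+1 -> R),
    [/\ gen_riemann_conditions n A a,
        forall b, b \in nodes <-> exists k, a k = b
      & forall x h f, D x h f = riemann_difference A a x h f].

Definition sym_gauss_nodes (q : R) (m : nat) : seq R :=
  0 :: [seq q ^+ i | i <- iota 0 m] ++ [seq - q ^+ i | i <- iota 0 m].

(* The order of the difference is n = 2 m. *)
Definition is_sym_gauss_difference (q : R) (m : nat) (D : difference) : Prop :=
  gen_riemann_difference_based_at (2 * m) (sym_gauss_nodes q m) D.

Definition qint (p : R) (k : nat) : R := \sum_(i < k) p ^+ i.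

Definition qfact (p : R) (k : nat) : R := \prod_(1 <= i < k.+1) qint p i.

(* Meaningful for k <= n only. *)
Definition qbinom (p : R) (n k : nat) : R :=
  qfact p n / (qfact p (n - k) * qfact p k).

Definition sym_gauss_tilde (q : R) (m : nat) : difference := fun x h f =>
  \sum_(k < m) (-1) ^+ k * q ^+ (k * k.+1) * qbinom (q ^+ 2) m.-1 k *
     (f (x + q ^+ (m.-1 - k) * h) + f (x - q ^+ (m.-1 - k) * h))
  - 2 * (\prod_(1 <= i < m) (1 - q ^+ (2 * i))) * f x.

Definition sym_gauss_lambda (q : R) (m : nat) : R :=
  (2 * m)`!%:R / (2 * \prod_(1 <= i < m) (q ^+ (2 * m) - q ^+ (2 * i))).

End GeneralizedRiemannDifferences.

(* Main.v *)
(* Put p = q ^+ 2.  Odd moments vanish by symmetry.  Up to the normalization, the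
   contribution of the non-central nodes to the moment of order 2 t is twice the
   left side of the homogeneous q-binomial theorem
     sum_k (-1)^k p^C(k,2) [N, k]_p y^(N-k) z^k = prod_(i < N) (y - z p^i)
   at N = m - 1, y = p^t, z = p.  The product cancels against the central node
   for t = 0, contains a zero factor for 0 < t < m, and determines lambda for
   t = m.  Uniqueness is Lagrange interpolation at the n + 1 nodes. *)

Require Import Defs.
From mathcomp Require Import all_boot all_order all_algebra.
From mathcomp Require Import reals.
From mathcomp Require Import ring.

Import Order.TTheory GRing.Theory Num.Theory.
Local Open Scope ring_scope.

(** * Newton interpolation and uniqueness of differences *)

Lemma newton_interpolation (F : fieldType) (g : F -> F) (s : seq F) :
  uniq s ->
  exists2 P : {poly F},
    (size P <= size s)%N & forall b, b \in s -> P.[b] = g b.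
Proof.
elim: s => [|c s IHs] /= => [_|/andP[c_s uniq_s]].
  by exists 0 => //; rewrite size_poly0.
have [P size_P P_g] := IHs uniq_s.
pose W := \prod_(b <- s) ('X - b%:P).
have Wc_neq0 : W.[c] != 0 by rewrite -[_ == 0]/(root W c) root_prod_XsubC.
(* [W] vanishes at the old nodes but not at [c], so this correction keeps the old values and fixes
   the one at [c]. *)
exists (P + ((g c - P.[c]) / W.[c]) *: W) => [|b].
  rewrite (leq_trans (size_polyD _ _))// geq_max (leq_trans size_P)//=.
  by rewrite (leq_trans (size_scale_leq _ _))// size_prod_XsubC.
rewrite inE hornerD hornerZ => /predU1P[->|b_s].
  by rewrite divfK// addrC subrK.
have /rootP-> : root W b by rewrite root_prod_XsubC.
by rewrite mulr0 addr0 P_g.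
Qed.

Section Uniqueness.
Context {R : realType}.

(** Expanding [P] in monomials and exchanging the sums leaves only moments of order at most n, all
    prescribed; order n alone survives. *)
Lemma gen_riemann_horner (n l : nat) (A a : 'I_l.+1 -> R) (P : {poly R}) :
  gen_riemann_conditions n A a -> (size P <= n.+1)%N ->
  \sum_k A k * P.[a k] = P`_n * n`!%:R.
Proof.
case=> _ _ moments size_P.
under eq_bigr => k _ do rewrite (horner_coef_wide _ size_P) mulr_sumr.
rewrite exchange_big (bigD1 ord_max)//= [X in _ + X]big1 ?addr0.
  under eq_bigr => k _ do rewrite mulrCA.
  by rewrite -mulr_sumr moments// eqxx.
move=> j j_neq; under eq_bigr => k _ do rewrite mulrCA.
by rewrite -mulr_sumr moments -1?ltnS// ifN ?mulr0.
Qed.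

(* Interpolating f on the nodes by a polynomial of degree at most n, any such
   difference takes the value n! times the coefficient of degree n. *)
Lemma gen_riemann_difference_unique (n : nat) (nodes : seq R)
    (D E : difference R) :
  uniq nodes -> (size nodes <= n.+1)%N ->
  gen_riemann_difference_based_at n nodes D ->
  gen_riemann_difference_based_at n nodes E ->
  forall x h f, D x h f = E x h f.
Proof.
move=> uniq_nodes size_nodes D_based E_based x h f.
have [P size_P P_f] :=
  newton_interpolation _ (fun b => f (x + b * h)) _ uniq_nodes.
have value (D' : difference R) : gen_riemann_difference_based_at n nodes D' ->
    D' x h f = P`_n * n`!%:R.
  case=> l [A [a [cond range ->]]].
  rewrite -(gen_riemann_horner _ _ _ _ _ cond (leq_trans size_P size_nodes)).
  by apply: eq_bigr => k _; rewrite P_f//; apply/range; exists k.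
by rewrite !value.
Qed.

End Uniqueness.

(** * q-binomial coefficients and the Gauss binomial formula *)

Section GaussBinomial.
Context {R : realType}.
Implicit Types (p y z : R) (n k : nat).

(** Positivity of p keeps every q-factorial invertible; the application has p = q^2. *)
Lemma qint_gt0 p k : 0 < p -> 0 < qint p k.+1.
Proof.
move=> p_gt0; rewrite /qint big_ord_recl expr0.
by rewrite ltr_wpDr// sumr_ge0// => i _; rewrite exprn_ge0// ltW.
Qed.

Lemma qintD p n k : qint p (n + k) = qint p n + p ^+ n * qint p k.
Proof.
rewrite /qint big_split_ord/= mulr_sumr; congr (_ + _).
by apply: eq_bigr => i _; rewrite exprD.
Qed.

Lemma qfact0 p : qfact p 0 = 1.
Proof. by rewrite /qfact big_nil. Qed.

Lemma qfactS p k : qfact p k.+1 = qfact p k * qint p k.+1.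
Proof. by rewrite /qfact big_nat_recr. Qed.

Lemma qfact_gt0 p k : 0 < p -> 0 < qfact p k.
Proof.
move=> p_gt0; elim: k => [|k IHk]; first by rewrite qfact0.
by rewrite qfactS mulr_gt0// qint_gt0.
Qed.

Lemma qbinom_gt0 p n k : 0 < p -> 0 < qbinom p n k.
Proof. by move=> p_gt0; rewrite divr_gt0 ?mulr_gt0 ?qfact_gt0. Qed.

Lemma qbinom0 p n : 0 < p -> qbinom p n 0 = 1.
Proof.
by move=> p_gt0; rewrite /qbinom subn0 qfact0 mulr1 divff// gt_eqF ?qfact_gt0.
Qed.

Lemma qbinomnn p n : 0 < p -> qbinom p n n = 1.
Proof.
by move=> p_gt0; rewrite /qbinom subnn qfact0 mul1r divff// gt_eqF ?qfact_gt0.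
Qed.

(** The q-Pascal rule, from [n+1] = [n-k] + p^(n-k) [k+1]. The case k = n is left out: truncated
    subtraction gives [qbinom p n n.+1] a nonzero value. *)
Lemma qbinomS p n k : 0 < p -> (k < n)%N ->
  qbinom p n.+1 k.+1 = qbinom p n k.+1 + p ^+ (n - k) * qbinom p n k.
Proof.
move=> p_gt0 /subnK; move: (n - k.+1)%N => d <-.
rewrite /qbinom -addSn !addnK -(addSnnS d k) !addnK addnS.
rewrite (qfactS _ (d.+1 + k)) (qfactS _ d) (qfactS _ k).
have -> : qint p (d.+1 + k).+1 = qint p d.+1 + p ^+ d.+1 * qint p k.+1.
  by rewrite -addnS qintD.
have := qfact_gt0 p k p_gt0; have := qfact_gt0 p d p_gt0.
have := qint_gt0 p k p_gt0; have := qint_gt0 p d p_gt0.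
move=> /lt0r_neq0 ? /lt0r_neq0 ? /lt0r_neq0 ? /lt0r_neq0 ?.
by field; do ?[apply/andP; split].
Qed.

(** Induction on n: multiplying by the last factor y - z p^n is matched by the q-Pascal rule. *)
Lemma gauss_binomial p y z n : 0 < p ->
  \sum_(k < n.+1) (-1) ^+ k * p ^+ 'C(k, 2) * qbinom p n k
      * y ^+ (n - k) * z ^+ k
  = \prod_(i < n) (y - z * p ^+ i).
Proof.
move=> p_gt0; elim: n => [|n IHn].
  by rewrite big_ord1 big_ord0 qbinom0// bin0n !expr0 !mulr1.
rewrite [RHS]big_ord_recr /= -IHn mulrBr.
(* The first term leaves the sum times y, the last leaves the sum times z p^n, and both leave the
   target; only inner terms need the q-Pascal rule. *)
rewrite [X in X * y]big_ord_recl [X in _ - X * _]big_ord_recr.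
rewrite big_ord_recl big_ord_recr /=.
rewrite !qbinom0// !qbinomnn// !subnn !subn0 !expr0.
have -> : \sum_(i < n) (-1) ^+ bump 0 i * p ^+ 'C(bump 0 i, 2)
    * qbinom p n.+1 (bump 0 i) * y ^+ (n.+1 - bump 0 i) * z ^+ bump 0 i
  = (\sum_(i < n) (-1) ^+ bump 0 i * p ^+ 'C(bump 0 i, 2)
      * qbinom p n (bump 0 i) * y ^+ (n - bump 0 i) * z ^+ bump 0 i) * y
    - (\sum_(i < n) (-1) ^+ i * p ^+ 'C(i, 2) * qbinom p n i
        * y ^+ (n - i) * z ^+ i) * (z * p ^+ n).
  rewrite !mulr_suml -sumrB; apply: eq_bigr => i _; rewrite /bump leq0n add1n.
  (* C(i+1,2) = C(i,2) + i supplies the p^i that completes p^(n-i) to p^n. *)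
  rewrite qbinomS// subSS binS bin1 (exprS (-1)) (exprS z).
  have -> : p ^+ n = p ^+ (n - i) * p ^+ i by rewrite -exprD subnK// ltnW.
  have -> : y ^+ (n - i) = y ^+ (n - i.+1) * y by rewrite -exprSr subnSK.
  by rewrite exprD; ring.
by rewrite /bump leq0n add1n binS bin1 exprD !exprS; ring.
Qed.

End GaussBinomial.

(** * Indexing a centre and m symmetric pairs *)

Section SymmetricFamily.
Context {T : Type} {m : nat} (v0 : T) (vp vn : 'I_m -> T).

(** The same encoding serves for weights and for nodes, which lines them up in [riemann_difference]
    with l = m + m. *)
Definition symmetric_family (k : 'I_(m + m).+1) : T :=
  if unlift ord0 k is Some j then
    match split j with inl i => vp i | inr i => vn i end
  else v0.

Lemma symmetric_family0 : symmetric_family ord0 = v0.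
Proof. by rewrite /symmetric_family unlift_none. Qed.

Lemma symmetric_family_pos i : symmetric_family (lift ord0 (lshift m i)) = vp i.
Proof. by rewrite /symmetric_family liftK (unsplitK (inl i)). Qed.

Lemma symmetric_family_neg i : symmetric_family (lift ord0 (rshift m i)) = vn i.
Proof. by rewrite /symmetric_family liftK (unsplitK (inr i)). Qed.

Definition symmetric_familyE :=
  (symmetric_family0, symmetric_family_pos, symmetric_family_neg).

End SymmetricFamily.

Variant symmetric_index_spec {m : nat} : 'I_(m + m).+1 -> Type :=
  | SymmetricIndex0 : symmetric_index_spec ord0
  | SymmetricIndexPos (i : 'I_m) : symmetric_index_spec (lift ord0 (lshift m i))
  | SymmetricIndexNeg (i : 'I_m) : symmetric_index_spec (lift ord0 (rshift m i)).

Lemma symmetric_indexP {m : nat} (k : 'I_(m + m).+1) : symmetric_index_spec k.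
Proof.
case: (unliftP ord0 k) => [j|] ->; last exact: SymmetricIndex0.
rewrite -(splitK j); case: (split j) => i.
  exact: SymmetricIndexPos.
exact: SymmetricIndexNeg.
Qed.

Lemma sum_symmetric_index {R : nmodType} {m : nat} (G : 'I_(m + m).+1 -> R) :
  \sum_k G k = G ord0
    + \sum_(i < m) (G (lift ord0 (lshift m i)) + G (lift ord0 (rshift m i))).
Proof. by rewrite big_ord_recl big_split_ord big_split. Qed.

(** * Nodes, moments and existence of the symmetric Gaussian difference *)

Section SymmetricGauss.
Context {R : realType}.
Variables (q : R).
Hypotheses (q_neq0 : q != 0) (q_neq1 : q != 1) (q_neqN1 : q != -1).

Let sqr_gt0 : 0 < q ^+ 2.
Proof. by rewrite lt0r sqrf_eq0 q_neq0 sqr_ge0. Qed.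

Let sqr_neq1 : q ^+ 2 != 1.
Proof. by rewrite sqrf_eq1 negb_or q_neq1. Qed.

Lemma expr_even_inj i j : q ^+ (2 * i) = q ^+ (2 * j) -> i = j.
Proof. by rewrite !exprM => /(ieexprIn sqr_gt0 sqr_neq1). Qed.

(** Since q may be negative, squaring passes to the positive base q^2. *)
Lemma expr_inj i j : q ^+ i = q ^+ j -> i = j.
Proof.
by move=> qij; apply: expr_even_inj; rewrite ![(2 * _)%N]mulnC !exprM qij.
Qed.

(** Squaring forces i = j, and then 2 q^i = 0. *)
Lemma expr_neqN i j : q ^+ i <> - q ^+ j.
Proof.
move=> qij; have ij : i = j.
  by apply: expr_even_inj; rewrite ![(2 * _)%N]mulnC !exprM qij sqrrN.
move: qij; rewrite ij => /eqP.
by rewrite -addr_eq0 -mulr2n mulrn_eq0/= expf_eq0 (negPf q_neq0) andbF.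
Qed.

Lemma sym_gauss_nodes_uniq m : uniq (sym_gauss_nodes q m).
Proof.
rewrite /= mem_cat cat_uniq negb_or.
have inj_pos : injective (fun i => q ^+ i) by exact: expr_inj.
have inj_neg : injective (fun i => - q ^+ i) by move=> i j /oppr_inj/expr_inj.
rewrite !map_inj_uniq// !iota_uniq/= andbT; apply/andP; split.
  apply/andP; split; apply/mapP => -[i _] /esym/eqP.
    by rewrite expf_eq0 (negPf q_neq0) andbF.
  by rewrite oppr_eq0 expf_eq0 (negPf q_neq0) andbF.
by apply/hasPn => _ /mapP[j _ ->]; apply/mapP => -[i _] /esym/expr_neqN.
Qed.

Lemma prod_expr_even_neq0 m :
  \prod_(1 <= i < m) (q ^+ (2 * m) - q ^+ (2 * i)) != 0.
Proof.
rewrite big_seq_cond prodf_seq_neq0; apply/allP => i.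
rewrite mem_index_iota => /andP[i_gt0 i_lt]; apply/implyP => _.
rewrite subr_eq0; apply/eqP => /expr_even_inj mi.
by rewrite mi ltnn in i_lt.
Qed.

Lemma prod_one_sub_expr_even_neq0 m :
  \prod_(1 <= i < m) (1 - q ^+ (2 * i)) != 0.
Proof.
rewrite big_seq_cond prodf_seq_neq0; apply/allP => i.
rewrite mem_index_iota => /andP[i_gt0 i_lt]; apply/implyP => _.
(* The constant 1 is read as q^(2 * 0). *)
rewrite subr_eq0; apply/eqP => /(expr_even_inj 0) i0.
by rewrite -i0 in i_gt0.
Qed.

Lemma sym_gauss_lambda_neq0 m : sym_gauss_lambda q m != 0.
Proof.
rewrite mulf_neq0 ?invr_eq0 ?mulf_neq0 ?prod_expr_even_neq0 ?pnatr_eq0//.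
by rewrite -lt0n fact_gt0.
Qed.

Lemma sym_gauss_weighted_sum (N t : nat) :
  \sum_(k < N.+1) (-1) ^+ k * q ^+ (k * k.+1) * qbinom (q ^+ 2) N k
      * q ^+ (N - k) ^+ (2 * t)
  = \prod_(1 <= i < N.+1) (q ^+ (2 * t) - q ^+ (2 * i)).
Proof.
rewrite (big_addn 0 _ 1) subn1 big_mkord.
transitivity (\prod_(i < N) ((q ^+ 2) ^+ t - q ^+ 2 * (q ^+ 2) ^+ i));
    last first.
  by apply: eq_bigr => i _; rewrite -exprS -!exprM addn1.
rewrite -gauss_binomial//; apply: eq_bigr => k _.
(* k(k+1) is even, with half C(k+1,2) = C(k,2) + k; the summand k becomes the power of z = q^2. *)
have -> : q ^+ (k * k.+1) = (q ^+ 2) ^+ 'C(k, 2) * (q ^+ 2) ^+ k.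
  rewrite -exprD -exprM; congr (_ ^+ _).
  have <- : 'C(k.+1, 2) = ('C(k, 2) + k)%N by rewrite binS bin1.
  by rewrite bin2 mul2n mulnC even_halfK// oddM/= andNb.
have -> : q ^+ (N - k) ^+ (2 * t) = (q ^+ 2) ^+ t ^+ (N - k).
  by rewrite -!exprM mulnC mulnA.
ring.
Qed.

(** Taking x = 0, h = 1 and a power function reads off a moment of the unnormalized weights. *)
Lemma sym_gauss_tilde_moment (m j : nat) : (0 < m)%N -> (j <= 2 * m)%N ->
  sym_gauss_tilde q m 0 1 (fun u => u ^+ j)
  = if j == (2 * m)%N then 2 * \prod_(1 <= i < m) (q ^+ (2 * m) - q ^+ (2 * i))
    else 0.
Proof.
case: m => // N _; rewrite /sym_gauss_tilde /= => j_le.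
have [j_odd|j_even] := boolP (odd j).
  rewrite ifN; last by apply: contraTneq j_odd => ->; rewrite mul2n odd_double.
  rewrite big1 => [|k _]; last first.
    rewrite !mulr1 add0r sub0r (exprNn (q ^+ _)).
    by rewrite -(signr_odd _ j) j_odd expr1 mulN1r subrr mulr0.
  by rewrite expr0n; case: j j_odd {j_le} => // ? _; rewrite mulr0 subrr.
have [t jE] : exists t, j = (2 * t)%N by exists j./2; rewrite mul2n even_halfK.
subst j; move: j_le; rewrite leq_mul2l eqn_mul2l /= => t_le.
have even_exprN u : (- u) ^+ (2 * t) = u ^+ (2 * t) by rewrite !exprM sqrrN.
under eq_bigr do
  rewrite !mulr1 add0r sub0r even_exprN -mulr2n -[X in _ * X]mulr_natl mulrCA.
(* Because 0^0 = 1, the central node counts for t = 0 only. *)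
rewrite -mulr_sumr sym_gauss_weighted_sum expr0n muln_eq0 /=.
case: (eqVneq t N.+1) => [->|t_neq]; first by rewrite mulr0 subr0.
case: t t_le t_neq {j_even even_exprN} => [|t] t_le t_neq.
  by rewrite eqxx muln0 mulr1 subrr.
rewrite mulr0 subr0 (bigD1_seq t.+1) ?iota_uniq//=; last first.
  by rewrite mem_index_iota /= ltn_neqAle t_neq.
by rewrite subrr mul0r mulr0.
Qed.

Lemma sym_gauss_differenceP (m : nat) : (0 < m)%N ->
  is_sym_gauss_difference q m
    (fun x h f => sym_gauss_lambda q m * sym_gauss_tilde q m x h f).
Proof.
move=> m_gt0.
(* Exponents descend from m - 1, so that weight k sits at the node given by the formula. *)
pose u (k : 'I_m) := q ^+ (m.-1 - k).
pose c (k : 'I_m) := sym_gauss_lambda q m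
  * ((-1) ^+ k * q ^+ (k * k.+1) * qbinom (q ^+ 2) m.-1 k).
pose c0 := - (sym_gauss_lambda q m
  * (2 * \prod_(1 <= i < m) (1 - q ^+ (2 * i)))).
pose A := symmetric_family c0 c c.
pose a := symmetric_family 0 u (fun k => - u k).
have diffE x h f : sym_gauss_lambda q m * sym_gauss_tilde q m x h f
    = riemann_difference A a x h f.
  rewrite /riemann_difference sum_symmetric_index /A /a !symmetric_familyE.
  rewrite mul0r addr0 /sym_gauss_tilde mulrBr addrC mulr_sumr mulrA mulNr.
  congr (_ + _); apply: eq_bigr => i _.
  by rewrite !symmetric_familyE mulrA mulrDr mulNr.
have lt_m (k : 'I_m) : (m.-1 - k < m)%N.
  by rewrite (leq_ltn_trans (leq_subr _ _))// prednK.
exists (m + m)%N, A, a; split=> //.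
- split.
  + have lambda_neq0 := sym_gauss_lambda_neq0 m.
    have c_neq0 k : c k != 0.
      have /lt0r_neq0 := qbinom_gt0 (q ^+ 2) m.-1 k sqr_gt0.
      by move=> ?; rewrite mulf_neq0// mulf_neq0// ?mulf_neq0 ?expf_neq0//
        ?oppr_eq0 ?oner_eq0.
    move=> k; case: (symmetric_indexP k) => [|i|i];
      rewrite /A !symmetric_familyE//.
    by rewrite /c0 oppr_eq0 mulf_neq0// mulf_neq0 ?pnatr_eq0//
      prod_one_sub_expr_even_neq0.
  + have u_inj : injective u.
      (* On indices at most m - 1, the truncated subtraction from m - 1 is an involution. *)
      have le_pred (i : 'I_m) : (i <= m.-1)%N by rewrite -ltnS prednK.
      move=> i j /expr_inj ij; apply/val_inj.
      by rewrite /= -(subKn (le_pred i)) ij subKn.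
    have u_neq0 i : 0 <> u i by apply/eqP; rewrite eq_sym expf_neq0.
    move=> k k'.
    case: (symmetric_indexP k) => [|i|i];
      case: (symmetric_indexP k') => [|i'|i'];
      rewrite /a !symmetric_familyE.
    * by [].
    * by move=> /u_neq0.
    * by move=> /eqP; rewrite eq_sym oppr_eq0 eq_sym => /eqP/u_neq0.
    * by move=> /esym/u_neq0.
    * by move=> /u_inj->.
    * by move=> /expr_neqN.
    * by move=> /eqP; rewrite oppr_eq0 eq_sym => /eqP/u_neq0.
    * by move=> /esym/expr_neqN.
    * by move=> /oppr_inj/u_inj->.
  + move=> j j_le.
    (* The moments of [A] and [a] are thus lambda times those already computed; for j = 2m the
       denominator of lambda cancels, leaving n!. *)
    have := diffE 0 1 (fun v => v ^+ j).
    rewrite /riemann_difference; under [in RHS]eq_bigr do rewrite add0r mulr1.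
    move=> <-; rewrite sym_gauss_tilde_moment//; case: eqP => _; last first.
      by rewrite mulr0.
    rewrite divfK// mulf_neq0 ?prod_expr_even_neq0 ?pnatr_eq0//.
- move=> b; rewrite inE mem_cat; split.
    have rev i : i \in iota 0 m -> exists k, u k = q ^+ i.
      rewrite mem_iota add0n => /= i_lt; exists (rev_ord (Ordinal i_lt)).
      by rewrite /u /= subnS predn_sub subKn// -ltnS prednK.
    case/or3P => [/eqP->|/mapP[i /rev[k uk] ->]|/mapP[i /rev[k uk] ->]].
    + by exists ord0; rewrite /a symmetric_familyE.
    + by exists (lift ord0 (lshift m k)); rewrite /a symmetric_familyE.
    + by exists (lift ord0 (rshift m k)); rewrite /a symmetric_familyE uk.
  case=> k <-; case: (symmetric_indexP k) => [|i|i];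
    rewrite /a /u !symmetric_familyE.
  + by rewrite eqxx.
  + by rewrite (map_f (fun i => q ^+ i)) ?orbT// mem_iota lt_m.
  + by rewrite (map_f (fun i => - q ^+ i)) ?orbT// mem_iota lt_m.
Qed.

End SymmetricGauss.

Theorem lemma1p3 (R : realType) (q : R) (m : nat)
    (hq0 : q != 0) (hq1 : q != 1) (hqN1 : q != -1) (hm : (0 < m)%N) :
  is_sym_gauss_difference q m
    (fun x h f => sym_gauss_lambda q m * sym_gauss_tilde q m x h f) /\
  (forall D : difference R, is_sym_gauss_difference q m D ->
     forall (x h : R) (f : R -> R),
       D x h f = sym_gauss_lambda q m * sym_gauss_tilde q m x h f).
Proof.
have based := sym_gauss_differenceP q hq0 hq1 hqN1 m hm.
split=> // D D_based x h f.
(* The list has 1 + m + m = n + 1 distinct nodes, as few as interpolation in degree n requires. *)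
apply: (gen_riemann_difference_unique _ _ _ _ _ _ D_based based).
  exact: sym_gauss_nodes_uniq.
by rewrite /= size_cat !size_map size_iota addnn mul2n.
Qed.
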